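(* Let $I\subset\mathbb R$ be a non-degenerate interval, let $N\ge 1$ be an integer and let $a_0,\ldots,a_N\in\mathbb R$ with $a_0\ne 0$ and $a_N\neq 0$. Assume that $$\mathcal R(a_N,\ldots,a_0)=\{(1,1),(\lambda_1,l_1),\ldots,(\lambda_p,l_p),(\mu_1,k_1),(\overline{\mu_1},k_1),\ldots,(\mu_q,k_q),(\overline{\mu_q},k_q)\}$$ and that $$|\lambda_1|\le\ldots\le|\lambda_p|<|\mu_1|\le\ldots\le|\mu_q|.$$ Let $b_Mr^M+\ldots+b_1r+b_0$ be a polynomial with real coefficients, $b_M\ne0$, such that $$\mathcal R(b_M,\ldots,b_0)=\{(1,1),(\lambda_1,l_1),\ldots,(\lambda_p,l_p)\}.$$ Then a continuous function $g\colon I\to I$ satisfies $$a_Ng^N(x)+\ldots+a_1g(x)+a_0x=0\quad\text{for all }x\in I$$ if and only if it satisfies $$b_Mg^M(x)+\ldots+b_1g(x)+b_0x=0\quad\text{for all }x\in I.$$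
   Context: $g^n$ denotes the $n$-th iterate of $g$. For real numbers $c_0,\ldots,c_K$ with $c_K\neq0$, $\mathcal R(c_K,\ldots,c_0)$ denotes the set $\{(r_1,k_1),\ldots,(r_s,k_s)\}$ of all pairs consisting of a complex root of the polynomial $c_Kr^K+\ldots+c_1r+c_0$ and its multiplicity, where $r_1,\ldots,r_s$ are the pairwise distinct complex roots. All roots listed in $\mathcal R$ are pairwise distinct (so no $\lambda_i$ equals $1$, and $1$ is a simple root); in particular, the listing of both $(\mu_j,k_j)$ and $(\overline{\mu_j},k_j)$ forces each $\mu_j$ to be non-real. Here $p,q$ are non-negative integers, and the inequality chain is read with the absent terms omitted. *)

(* Defs.v *)
From HB Require Import structures.
From mathcomp Require Import all_boot all_order all_algebra.
From mathcomp Require Import all_classical all_reals all_analysis.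
From mathcomp.real_closed Require Import complex.

Set Implicit Arguments.
Unset Strict Implicit.
Unset Printing Implicit Defensive.

Import Order.TTheory GRing.Theory Num.Theory.
Import numFieldNormedType.Exports.

Local Open Scope classical_set_scope.
Local Open Scope ring_scope.
Local Open Scope complex_scope.

Definition recurrence_poly (R : realType) (K : nat) (c : 'I_K.+1 -> R) : {poly R[i]} :=
  \sum_(n < K.+1) (c n)%:C *: 'X^n.

Definition roots_mult (R : realType) (K : nat) (c : 'I_K.+1 -> R) :
    set (R[i] * nat) :=
  [set rk | root (recurrence_poly c) rk.1 /\ rk.2 = mup rk.1 (recurrence_poly c)].

(* Equality of sets alone would allow repetitions in [s]; [uniq] records that
   the listed roots are pairwise distinct. *)
Definition roots_mult_listed (R : realType) (K : nat) (c : 'I_K.+1 -> R)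
    (s : seq (R[i] * nat)) : Prop :=
  uniq (unzip1 s) /\ roots_mult c = [set rk | rk \in s].

(* The chain |lam_1| <= ... <= |lam_p| < |mu_1| <= ... <= |mu_q|, by comparison
   of neighbours; the middle inequality is void when p = 0 or q = 0. *)
Definition modulus_chain (R : realType) (p q : nat)
    (lam : 'I_p -> R[i]) (mu : 'I_q -> R[i]) : Prop :=
  [/\ forall i j : 'I_p, j = i.+1 :> nat -> `|lam i| <= `|lam j|,
      forall (i : 'I_p) (j : 'I_q), i.+1 = p -> j = 0%N :> nat ->
        `|lam i| < `|mu j|
    & forall i j : 'I_q, j = i.+1 :> nat -> `|mu i| <= `|mu j| ].

Definition satisfies_iter_eq (R : realType) (I : set R) (K : nat)
    (c : 'I_K.+1 -> R) (g : R -> R) : Prop :=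
  forall x, I x -> \sum_(n < K.+1) c n * iter n g x = 0.

(* Main.v *)
(* The polynomial [b] divides [a], so only the direction from [a] to [b] needs an argument.
   As [a_0 <> 0], a solution g is injective, hence strictly monotone, hence g o g is
   increasing: along an orbit u_n = g^n(x) the differences d_n = u_(n+1) - u_n have
   the same sign as d_(n+2j). They satisfy a recurrence whose characteristic polynomial
   is A C, with A and C the parts coming from the lambda_i and from the mu_j (1 being a
   simple root, differencing removes it). A non-real mu has a power mu^(2^m), m >= 1, with
   real part <= 0, so it is a root of a real polynomial in X^2 with nonnegative
   coefficients and positive constant term; hence C divides such a polynomial T. Fix rho
   with |lambda_i| < rho < |mu_j|. The sequence T(E) d, E being the shift, is annihilated
   by A(E), so it is O(rho^n); and |d_n| <= |(T(E) d)_n| / T(0) since all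
   the terms of (T(E) d)_n have the same sign, so d_n = O(rho^n). Then A(E) d is O(rho^n)
   and annihilated by C(E), all of whose roots have modulus larger than rho: it is 0. *)

Require Import Defs.
From HB Require Import structures.
From mathcomp Require Import all_boot all_order all_algebra.
From mathcomp Require Import all_classical all_reals all_analysis.
From mathcomp.real_closed Require Import complex.
From mathcomp Require Import ring.

Set Implicit Arguments.
Unset Strict Implicit.
Unset Printing Implicit Defensive.

Import Order.TTheory GRing.Theory Num.Theory.
Import numFieldNormedType.Exports.

Local Open Scope classical_set_scope.
Local Open Scope ring_scope.
Local Open Scope complex_scope.

(* The functional X^n |-> u_n: the n-th term of the sequence p(E) u, E the shift, is
   [moment u (p * 'X^n)], so that recurrences become statements about a linear form. *)
Definition moment (F : fieldType) (u : nat -> F) (p : {poly F}) : F :=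
  \sum_(i < size p) p`_i * u i.

Lemma moment_widen (F : fieldType) (u : nat -> F) (p : {poly F}) n :
  (size p <= n)%N -> moment u p = \sum_(i < n) p`_i * u i.
Proof.
move=> pn; rewrite /moment (big_ord_widen _ (fun i => p`_i * u i) pn) big_mkcond.
apply: eq_bigr => i _; case: ltnP => // /(nth_default 0) ->.
by rewrite mul0r.
Qed.

Lemma moment_is_scalar (F : fieldType) (u : nat -> F) : scalar (moment u).
Proof.
move=> a p q /=; set n := maxn (size p) (size q).
have szZ : (size (a *: p + q)%R <= n)%N.
  rewrite (leq_trans (size_polyD _ _)) // geq_max leq_maxr andbT.
  by rewrite (leq_trans (size_scale_leq _ _)) // leq_maxl.
rewrite (moment_widen u szZ) (moment_widen u (leq_maxl _ _ : (size p <= n)%N)).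
rewrite (moment_widen u (leq_maxr _ _ : (size q <= n)%N)).
rewrite mulr_sumr -big_split; apply: eq_bigr => i _ /=.
by rewrite coefD coefZ mulrDl mulrA.
Qed.

HB.instance Definition _ (F : fieldType) (u : nat -> F) :=
  GRing.isLinear.Build F {poly F} F *%R (moment u) (moment_is_scalar u).

Lemma momentXn (F : fieldType) (u : nat -> F) n : moment u 'X^n = u n.
Proof.
rewrite /moment size_polyXn big_ord_recr /= coefXn eqxx mul1r big1 ?add0r //.
by move=> i _; rewrite coefXn ltn_eqF ?mul0r.
Qed.

Section LinearForm.
Variables (F : fieldType) (L : {scalar {poly F}}).

Lemma scalar_mul_coef (p q : {poly F}) :
  L (p * q) = \sum_(i < size q) q`_i * L (p * 'X^i).
Proof.
rewrite -{1}[q]coefK poly_def mulr_sumr linear_sum; apply: eq_bigr => i _ /=.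
by rewrite -scalerAr linearZ.
Qed.

Lemma scalar_ideal (p q : {poly F}) :
  (forall n, L (p * 'X^n) = 0) -> L (p * q) = 0.
Proof. by move=> p0; rewrite scalar_mul_coef big1 // => i _; rewrite p0 mulr0. Qed.

(** Writing X as z + (X - z) turns the removal of one linear factor into a first-order recurrence;
    the growth lemmas peel off factors this way. *)
Lemma scalar_shift (p : {poly F}) (z : F) n :
  L (p * 'X^(n.+1)) = z * L (p * 'X^n) + L (p * ('X - z%:P) * 'X^n).
Proof.
rewrite -linearZ -linearD /=; congr (L _).
by rewrite -mul_polyC exprS; ring.
Qed.

End LinearForm.

(** * Geometric growth bounds and linear recurrences *)

Definition geo_bounded (F : numFieldType) (rho : F) (e : nat -> F) :=
  exists K, forall n, `|e n| <= K * rho ^+ n.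

Lemma geo_bound_ge0 (F : numFieldType) (rho K : F) (e : nat -> F) :
  (forall n, `|e n| <= K * rho ^+ n) -> 0 <= K.
Proof. by move/(_ 0%N); rewrite expr0 mulr1; apply: le_trans. Qed.

Section Growth.
Variables (F : numFieldType) (L : {scalar {poly F}}) (rho : F).
Hypothesis rho_gt0 : 0 < rho.
Local Notation orbit p := (fun n => L (p * 'X^n)).

Lemma geo_bounded_mulXsubC (p : {poly F}) (z : F) :
  geo_bounded rho (orbit p) -> geo_bounded rho (orbit (p * ('X - z%:P))).
Proof.
case=> K HK; exists (K * rho + `|z| * K) => n.
have -> : L (p * ('X - z%:P) * 'X^n) = L (p * 'X^(n.+1)) - z * L (p * 'X^n).
  by rewrite (scalar_shift L p z) addrAC subrr add0r.
rewrite (le_trans (ler_normB _ _)) // normrM mulrDl -!mulrA -exprS.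
by rewrite lerD ?ler_wpM2l.
Qed.

(** The sequence satisfies u_(n+1) = z u_n + O(rho^n); as |z| < rho, a large enough constant
    survives the induction. *)
Lemma geo_bounded_divXsubC (p : {poly F}) (z : F) : `|z| < rho ->
  geo_bounded rho (orbit (p * ('X - z%:P))) -> geo_bounded rho (orbit p).
Proof.
move=> zrho [K HK]; have K0 := geo_bound_ge0 HK.
have drho : 0 < rho - `|z| by rewrite subr_gt0.
(* The second summand c solves |z| c + K = rho c; the first covers n = 0 and only adds slack
   later. *)
exists (`|L p| + K / (rho - `|z|)); elim=> [|n IHn].
  by rewrite !expr0 !mulr1 lerDl divr_ge0 // ltW.
rewrite (scalar_shift L p z) (le_trans (ler_normD _ _)) // normrM.
apply: le_trans (lerD (ler_wpM2l (normr_ge0 z) IHn) (HK n)) _.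
rewrite exprS !mulrA -mulrDl ler_pM2r ?exprn_gt0 //.
rewrite -subr_ge0; set S := (X in 0 <= X).
have -> : S = `|L p| * (rho - `|z|).
  by rewrite /S; field; rewrite gt_eqF.
by rewrite mulr_ge0 // ltW.
Qed.

End Growth.

Section ClosedGrowth.
Variables (F : numClosedFieldType) (L : {scalar {poly F}}) (rho : F).
Hypothesis rho_gt0 : 0 < rho.

Lemma geo_bounded_mul (p q : {poly F}) :
  geo_bounded rho (fun n => L (p * 'X^n)) ->
  geo_bounded rho (fun n => L (p * q * 'X^n)).
Proof.
have [r ->] := closed_field_poly_normal q => Hp.
set c := lead_coef _.
have [K HK] : geo_bounded rho (fun n => L (p * \prod_(z <- r) ('X - z%:P) * 'X^n)).
  elim: r p Hp {c} => [|z r IHr] p Hp; first by rewrite big_nil mulr1.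
  by rewrite big_cons mulrA; apply/IHr/geo_bounded_mulXsubC.
exists (`|c| * K) => n.
by rewrite -scalerAr -scalerAl linearZ normrM -[leRHS]mulrA ler_wpM2l.
Qed.

Lemma geo_bounded_div (p q : {poly F}) :
  q \is monic -> (forall z, root q z -> `|z| < rho) ->
  geo_bounded rho (fun n => L (p * q * 'X^n)) ->
  geo_bounded rho (fun n => L (p * 'X^n)).
Proof.
have [r Eq] := closed_field_poly_normal q.
move=> /monicP q1; move: Eq; rewrite q1 scale1r => -> Hr.
have {Hr} : forall z, z \in r -> `|z| < rho.
  by move=> z zr; apply: Hr; rewrite root_prod_XsubC.
elim: r p => [|z r IHr] p Hr; first by rewrite big_nil mulr1.
rewrite big_cons mulrA => /IHr Hp; apply: (geo_bounded_divXsubC rho_gt0 (z := z)).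
  by apply: Hr; rewrite mem_head.
by apply: Hp => w wr; apply: Hr; rewrite inE wr orbT.
Qed.

End ClosedGrowth.

Lemma expr_unbounded (R : realType) (x K : R) : 1 < x -> exists n, K < x ^+ n.
Proof.
move=> x1; have dx : 0 < x - 1 by rewrite subr_gt0.
(* Bernoulli's inequality, from x^n - 1 = (x - 1)(1 + ... + x^(n-1)). *)
have bern n : (x - 1) * n%:R <= x ^+ n.
  rewrite -[x ^+ n](subrK 1) ler_wpDr // subrX1 ler_wpM2l ?(ltW dx) //.
  have -> : n%:R = \sum_(i < n) 1 :> R by rewrite sumr_const card_ord.
  apply: ler_sum => i _.
  by rewrite exprn_ege1 // ltW.
exists (Num.bound `|K / (x - 1)|); apply: lt_le_trans (bern _).
rewrite mulrC -ltr_pdivrMr // (le_lt_trans (ler_norm _)) //.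
by rewrite archi_boundP.
Qed.

Lemma geo_bounded_geometric (R : realType) (rho z c : R[i]) :
  0 < rho -> rho < `|z| -> geo_bounded rho (fun n => c * z ^+ n) -> c = 0.
Proof.
move=> rho0 rhoz [K HK]; apply/eqP/contraT => c0.
have c_gt0 : 0 < `|c| by rewrite normr_gt0.
have K0 := geo_bound_ge0 HK.
(* If c were nonzero, the powers of |z| / rho > 1 would stay below K / |c|. Both quotients are real,
   so the contradiction is reached in [R]. *)
have /complex_realP[y Ey] : `|z| / rho \is Num.real.
  by rewrite realE divr_ge0 // ltW.
have /complex_realP[k Ek] : K / `|c| \is Num.real by rewrite realE divr_ge0.
have [|n] := @expr_unbounded R y k.
  by rewrite -ltcR -Ey ltr_pdivlMr // mul1r.
rewrite -ltcR rmorphXn /= -Ey -Ek expr_div_n ltr_pdivrMr // mulrAC.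
rewrite ltr_pdivlMr ?exprn_gt0 // => /lt_geF; apply: contraFT => _.
by rewrite mulrC -normrX -normrM.
Qed.

(** Induction on the linear factors of [q]: a sequence killed by X - z is c z^n, and with |z| > rho
    this is O(rho^n) only for c = 0. *)
Lemma geo_bounded_annihilated (R : realType) (L : {scalar {poly R[i]}})
    (rho : R[i]) (p q : {poly R[i]}) :
  0 < rho -> q != 0 -> (forall z, root q z -> rho < `|z|) ->
  geo_bounded rho (fun n => L (p * 'X^n)) ->
  (forall n, L (p * q * 'X^n) = 0) -> forall n, L (p * 'X^n) = 0.
Proof.
move=> rho0; have [r] := closed_field_poly_normal q.
rewrite -lead_coef_eq0; move: (lead_coef q) => c -> c0 Hr {q}.
have {}Hr : forall z, z \in r -> rho < `|z|.
  by move=> z zr; apply: Hr; rewrite rootZ ?root_prod_XsubC.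
move=> Hp Hq; have {Hq} : forall n, L (p * \prod_(z <- r) ('X - z%:P) * 'X^n) = 0.
  move=> n; have /eqP := Hq n; rewrite -scalerAr -scalerAl linearZ mulf_eq0.
  by rewrite (negPf c0) => /eqP.
elim: r p Hr Hp => [|z r IHr] p Hr Hp; first by rewrite big_nil mulr1.
rewrite big_cons mulrA => /IHr Hz.
have {Hz} Lz n : L (p * ('X - z%:P) * 'X^n) = 0.
  apply: Hz; last exact: geo_bounded_mulXsubC.
  by move=> w wr; apply: Hr; rewrite inE wr orbT.
have Lp n : L (p * 'X^n) = L p * z ^+ n.
  elim: n => [|n IHn]; first by rewrite !expr0 !mulr1.
  by rewrite (scalar_shift L p z) Lz addr0 IHn exprS mulrCA.
have Lp0 : L p = 0.
  apply: (@geo_bounded_geometric R rho z) => //.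
    by apply: Hr; rewrite mem_head.
  by case: Hp => K HK; exists K => n; rewrite -Lp.
by move=> n; rewrite Lp Lp0 mul0r.
Qed.

(** * Non-real numbers as roots of even polynomials with nonnegative coefficients *)

(** Induction on n with |Re z| <= 2^n |Im z|; for n = 0, Re (z^2) = x^2 - y^2 <= 0. The exponent is
    kept even for the sake of the polynomial built from it. *)
Lemma nonreal_pow2_Re_le0 (R : realType) (z : R[i]) :
  complex.Im z != 0 -> exists m, complex.Re (z ^+ (2 ^ m.+1)) <= 0.
Proof.
move=> y0; have [n] : exists n, `|complex.Re z| <= 2 ^+ n * `|complex.Im z|.
  have [n] := @expr_unbounded R 2 (`|complex.Re z| / `|complex.Im z|) (ltr1n _ _).
  by rewrite ltr_pdivrMr ?normr_gt0 // => /ltW; exists n.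
(* As long as [Re (z ^+ 2) > 0], squaring at least doubles [|Im z| / |Re z|]. *)
elim: n z y0 => [|n IHn] z y0 le_xy.
  exists 0%N; rewrite expn1 expr2; case: z y0 le_xy => x y /= y0.
  rewrite expr0 mul1r subr_le0 -!expr2 => xy.
  by rewrite -[x ^+ 2]real_normK ?num_real //
    -[y ^+ 2]real_normK ?num_real // lerXn2r ?nnegrE.
have [le0|gt0] := leP (complex.Re (z ^+ 2)) 0; first by exists 0%N.
have [||m Hm] := IHn (z ^+ 2); last by exists m.+1; rewrite expnS exprM.
  all: case: z y0 le_xy gt0 => x y /= y0 le_xy; rewrite -?expr2.
  move=> gt0; rewrite [y * x]mulrC -mulr2n mulrn_eq0 /= mulf_neq0 //.
  by apply: contraTneq gt0 => ->; rewrite expr0n /= sub0r oppr_gt0 -leNgt sqr_ge0.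
move=> gt0; rewrite gtr0_norm // [y * x]mulrC -mulr2n normrMn normrM.
rewrite (_ : _ * _ = `|x| * (2 ^+ n.+1 * `|y|)); last by rewrite exprS; ring.
rewrite (@le_trans _ _ (x ^+ 2)) ?lerBlDr ?lerDl ?sqr_ge0 //.
by rewrite -[x ^+ 2]real_normK ?num_real // expr2 ler_wpM2l.
Qed.

(** Over [R[i]] the relation [0 <=] includes being real, so these are real polynomials in X^2. *)
Definition even_nonneg (F : numDomainType) (p : {poly F}) :=
  0 < p`_0 /\ forall i, 0 <= p`_i /\ (odd i -> p`_i = 0).

Lemma even_nonneg1 (F : numDomainType) : even_nonneg (1 : {poly F}).
Proof.
split=> [|i]; rewrite coef1 ?ltr01 //; split; first exact: ler0n.
by case: i.
Qed.

Lemma even_nonnegM (F : numDomainType) (p q : {poly F}) :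
  even_nonneg p -> even_nonneg q -> even_nonneg (p * q).
Proof.
move=> [p0 Hp] [q0 Hq]; split=> [|i]; first by rewrite coef0M mulr_gt0.
rewrite coefM; split.
  by apply: sumr_ge0 => j _; rewrite mulr_ge0 //; [case: (Hp j)|case: (Hq (i - j)%N)].
move=> oi; apply: big1 => j _; have [oj|ej] := boolP (odd j).
  by case: (Hp j) => _ ->; rewrite ?mul0r.
case: (Hq (i - j)%N) => _ ->; rewrite ?mulr0 //.
by rewrite oddB ?leq_ord // oi (negPf ej).
Qed.

Lemma even_nonnegX (F : numDomainType) (p : {poly F}) n :
  even_nonneg p -> even_nonneg (p ^+ n).
Proof.
move=> Hp; elim: n => [|n IHn]; first exact: even_nonneg1.
by rewrite exprS; apply: even_nonnegM.
Qed.

(** With w = z^k and k a power of 2 such that Re w <= 0, the witness is X^(2k) - 2 Re(w) X^k +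
    |w|^2. *)
Lemma nonreal_pair_dvd (R : realType) (z : R[i]) : complex.Im z != 0 ->
  exists p, even_nonneg p /\ ('X - z%:P) * ('X - (z^*)%:P) %| p.
Proof.
move=> y0; have [m Hm] := nonreal_pow2_Re_le0 y0.
set w := z ^+ (2 ^ m.+1) in Hm; set k := (2 ^ m.+1)%N in w Hm.
have k0 : (0 < k)%N by rewrite expn_gt0.
have z0 : z != 0 by apply: contraNneq y0 => ->.
exists (('X^k - w%:P) * ('X^k - (w^*)%:P)); split; last first.
  have dvdX x : 'X - x%:P %| 'X^k - (x ^+ k)%:P.
    by rewrite dvdp_XsubCl rootE !hornerE subrr.
  by rewrite dvdp_mul // rmorphXn.
have -> : ('X^k - w%:P) * ('X^k - (w^*)%:P) =
    'X^(k + k) - (w + w^*) *: 'X^k + (`|w| ^+ 2)%:P :> {poly R[i]}.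
  by rewrite sqr_normc -mul_polyC !polyCD !polyCM exprD; ring.
have s_le0 : 0 <= - (w + w^*).
  by rewrite addcJ -mulrN mulr_ge0 // -rmorphN ler0c oppr_ge0.
split=> [|i]; rewrite !coefE.
  rewrite [(0 == _)%N]ltn_eqF ?addn_gt0 ?k0 // [(0 == _)%N]ltn_eqF //=.
  by rewrite mulr0 subr0 add0r exprn_gt0 // normr_gt0 expf_neq0.
split.
  rewrite -mulNr !addr_ge0 ?mulr_ge0 ?ler0n //.
  by case: (i == 0)%N => //; rewrite exprn_ge0.
move=> oi; have ek : odd k = false by rewrite oddX.
do 3! [rewrite (_ : (i == _)%N = false); last by apply: contraTF oi => /eqP ->;
  rewrite ?oddD ?ek].
by rewrite mulr0 subr0 addr0.
Qed.

Lemma even_nonneg_moment (F : numDomainType) (p : {poly F}) (e : nat -> F) :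
  even_nonneg p -> (forall i, 0 <= e i.*2) ->
  p`_0 * e 0%N <= \sum_(i < size p) p`_i * e i.
Proof.
move=> [p0 Hp] He; have : size p != 0%N.
  by rewrite size_poly_eq0; apply: contraTneq p0 => ->; rewrite coef0 ltxx.
case: (size p) => // n _; rewrite big_ord_recl /= lerDl sumr_ge0 // => i _.
have [oj|ej] := boolP (odd (bump 0 i)); first by rewrite (Hp _).2 ?mul0r.
by rewrite mulr_ge0 ?(Hp _).1 // -[bump 0 i]odd_double_half (negPf ej) add0n.
Qed.

(** * From a listing of roots to a factorization *)

Lemma recurrence_poly_factor (R : realType) K (c : 'I_K.+1 -> R) s :
  c ord_max != 0 -> roots_mult_listed c s ->
  recurrence_poly c = (c ord_max)%:C *: \prod_(rk <- s) ('X - rk.1%:P) ^+ rk.2.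
Proof.
move=> cK0 [us Es]; set P := recurrence_poly c.
have coefP i (iK : (i < K.+1)%N) : P`_i = (c (Ordinal iK))%:C.
  rewrite /P /recurrence_poly coef_sum (bigD1 (Ordinal iK)) //= coefZ coefXn eqxx.
  rewrite mulr1 big1 ?addr0 // => j ji.
  rewrite coefZ coefXn; case: eqVneq => [ij|]; last by rewrite mulr0.
  by rewrite -val_eqE /= ij eqxx in ji.
have szP : size P = K.+1.
  apply/eqP; rewrite eqn_leq; apply/andP; split.
    apply: (leq_trans (size_sum _ _ _)); apply/bigmax_leqP => i _.
    by rewrite (leq_trans (size_scale_leq _ _)) // size_polyXn.
  rewrite ltnNge; apply: contraNN cK0 => /leq_sizeP/(_ K (leqnn K))/eqP.
  rewrite (coefP _ (ltnSn K)) (_ : Ordinal _ = ord_max); last exact: val_inj.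
  by rewrite -(rmorph0 (real_complex R)) (inj_eq (@complexI R)).
have lP : lead_coef P = (c ord_max)%:C.
  rewrite /lead_coef szP /= (coefP _ (ltnSn K)).
  by rewrite (_ : Ordinal _ = ord_max) //; apply: val_inj.
have P0 : P != 0 by rewrite -size_poly_eq0 szP.
have [r Er] := closed_field_poly_normal P; rewrite lP in Er.
rewrite {1}Er; congr (_ *: _).
have cK0' : (c ord_max)%:C != 0 by rewrite -lP lead_coef_eq0.
have mem_s rk : (rk \in s) = root P rk.1 && (rk.2 == mup rk.1 P).
  have -> : (rk \in s) = `[< [set rk | rk \in s] rk >].
    by apply/idP/asboolP.
  by rewrite -Es; apply/asboolP/andP => -[Hr] /eqP.
have rootP z : root P z = (z \in r) by rewrite Er rootZ // root_prod_XsubC.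
have mupP z : mup z P = count_mem z r.
  by rewrite Er -mul_polyC mupMr ?mu_prod_XsubC // rootC.
(* [r] repeats each root as often as its multiplicity. Both [undup r] and the roots listed in [s]
   are free of repetitions, so they can be matched, the multiplicity becoming an exponent. *)
have rs : perm_eq (undup r) (unzip1 s).
  apply: uniq_perm; rewrite ?undup_uniq // => z; rewrite mem_undup -rootP.
  apply/idP/mapP => [rz|[rk + ->]]; last by rewrite mem_s => /andP[].
  by exists (z, mup z P); rewrite // mem_s rz eqxx.
rewrite -big_undup_iterop_count (perm_big _ rs) big_map.
by apply: eq_big_seq => rk; rewrite mem_s => /andP[_ /eqP ->]; rewrite mupP.
Qed.

Lemma uniq_flatten (T S : eqType) (f : S -> seq T) (s : seq S) :
  uniq (flatten [seq f y | y <- s]) -> {in s, forall x, uniq (f x)}.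
Proof.
elim: s => //= y s IHs; rewrite cat_uniq => /and3P[uy _ us] x.
by rewrite inE => /predU1P[->|/(IHs us)].
Qed.

Lemma nonreal_pairs_dvd (R : realType) (J : Type) (s : seq J) (z : J -> R[i])
    (k : J -> nat) : (forall j, complex.Im (z j) != 0) ->
  exists p, even_nonneg p /\
    \prod_(j <- s) (('X - (z j)%:P) ^+ k j * ('X - ((z j)^*)%:P) ^+ k j) %| p.
Proof.
move=> zI; elim: s => [|j s [p [Hp dvdp]]].
  by exists 1; rewrite big_nil dvdpp; split=> //; apply: even_nonneg1.
have [r [Hr dvdr]] := nonreal_pair_dvd (zI j).
exists (r ^+ k j * p); split; first by apply/even_nonnegM/Hp/even_nonnegX.
by rewrite big_cons -exprMn dvdp_mul // dvdp_exp2r.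
Qed.

(** * Elimination of the factor with large roots *)

(** To be used with [p] = X - 1, [q] = A and [r] = C; then [L (p * 'X^n)] is the difference d_n, and
    [t] is the polynomial T. *)
Lemma nonreal_part_vanishes (R : realType) (L : {scalar {poly R[i]}})
    (rho : R[i]) (p q r : {poly R[i]}) :
  0 < rho -> q \is monic -> (forall z, root q z -> `|z| < rho) ->
  r != 0 -> (forall z, root r z -> rho < `|z|) ->
  (exists t, even_nonneg t /\ r %| t) ->
  (forall n, (forall i, 0 <= L (p * 'X^(n + i.*2))) \/
             (forall i, L (p * 'X^(n + i.*2)) <= 0)) ->
  (forall n, L (p * q * r * 'X^n) = 0) ->
  forall n, L (p * q * 'X^n) = 0.
Proof.
move=> rho0 q_monic q_roots r0 r_roots [t [Ht /dvdpP[t' Et]]] L_sign L0.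
have [K HK] : geo_bounded rho (fun n => L (p * t * 'X^n)).
  (* The constant 0 works because [p * t * q] is a multiple of [p * q * r]. *)
  apply: (geo_bounded_div rho0 q_monic q_roots); exists 0 => n.
  rewrite (_ : p * t * q * 'X^n = p * q * r * (t' * 'X^n)); last by rewrite Et; ring.
  by rewrite scalar_ideal // normr0 mul0r.
have t0 : 0 < t`_0 by case: Ht.
have Hp : geo_bounded rho (fun n => L (p * 'X^n)).
  exists (K / t`_0) => n; rewrite mulrAC ler_pdivlMr // mulrC.
  apply: le_trans (HK n).
  have -> : L (p * t * 'X^n) = \sum_(i < size t) t`_i * L (p * 'X^(n + i)).
    rewrite mulrAC scalar_mul_coef; apply: eq_bigr => i _.
    by rewrite -mulrA -exprD.
  rewrite -[t`_0]gtr0_norm // -normrM.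
  (* All nonzero terms of the sum share one sign, so its modulus is at least that of the term of
     index 0. *)
  have [Ln|Ln] := L_sign n.
    have /(_ Ht Ln) := @even_nonneg_moment _ t (fun i => L (p * 'X^(n + i))).
    rewrite addn0 => le_t; have ge0 : 0 <= t`_0 * L (p * 'X^n).
      by have := Ln 0%N; rewrite double0 addn0 => Ln0; rewrite mulr_ge0 // ltW.
    by rewrite !ger0_norm // (le_trans ge0).
  have Ln' i : 0 <= - L (p * 'X^(n + i.*2)) by rewrite oppr_ge0.
  have /(_ Ht Ln') := @even_nonneg_moment _ t (fun i => - L (p * 'X^(n + i))).
  under eq_bigr do rewrite mulrN.
  rewrite sumrN addn0 mulrN => le_t; have ge0 : 0 <= - (t`_0 * L (p * 'X^n)).
    by have := Ln' 0%N; rewrite double0 addn0 => Ln0; rewrite -mulrN mulr_ge0 // ltW.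
  by rewrite -normrN -[leRHS]normrN !ger0_norm // (le_trans ge0).
exact: geo_bounded_annihilated rho0 r0 r_roots (geo_bounded_mul q Hp) L0.
Qed.

(** The midpoint of |lambda_p| and |mu_1| separates. If only one family is present, |mu_1| / 2 or
    |lambda_p| + 1 does; the former is positive because mu_1 is nonzero. *)
Lemma modulus_chain_separation (R : realType) p q (lam : 'I_p -> R[i])
    (mu : 'I_q -> R[i]) :
  modulus_chain lam mu -> (forall j, mu j != 0) ->
  exists rho, [/\ 0 < rho, forall i, `|lam i| < rho & forall j, rho < `|mu j|].
Proof.
case=> lam_mon lam_mu mu_mon mu0.
have lam_max (i0 : 'I_p) : i0.+1 = p -> forall i, `|lam i| <= `|lam i0|.
  move=> Ep i; have [m] := ubnP (p - i); elim: m i => // m IHm i le_m.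
  have [Ei|Ni] := eqVneq i i0; first by rewrite Ei.
  have i1p : (i.+1 < p)%N.
    have ip := ltn_ord i; rewrite ltn_neqAle ip andbT.
    by apply: contraNneq Ni => Ei; apply/eqP/val_inj/succn_inj; rewrite /= Ei Ep.
  apply: le_trans (lam_mon i (Ordinal i1p) erefl) (IHm _ _) => /=.
  by rewrite subnS prednK ?subn_gt0 ?ltn_ord // -ltnS.
have mu_min (j0 : 'I_q) : j0 = 0%N :> nat -> forall j, `|mu j0| <= `|mu j|.
  move=> E0 [j]; elim: j => [|j IHj] jq.
    by rewrite (_ : Ordinal jq = j0) //; apply: val_inj; rewrite /= E0.
  exact: le_trans (IHj (ltnW jq)) (mu_mon _ _ _).
case: p q lam mu lam_mon lam_mu mu_mon mu0 lam_max mu_min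
  => [|p] [|q] lam mu lam_mon lam_mu mu_mon mu0 lam_max mu_min.
- by exists 1; split=> [||[]]; rewrite ?ltr01 // => -[].
- have m0 : 0 < `|mu ord0| by rewrite normr_gt0.
  exists (`|mu ord0| / 2); split=> [|[]//|j]; first by rewrite divr_gt0.
  by rewrite (lt_le_trans _ (mu_min ord0 _ j)) // ltr_pdivrMr // mulr_natr mulr2n ltrDl.
- exists (`|lam ord_max| + 1); split=> [|i|[]//]; first by rewrite ltr_wpDl.
  by rewrite (le_lt_trans (lam_max ord_max _ i)) // ltrDl.
have lt_lm : `|lam ord_max| < `|mu ord0| by apply: lam_mu.
exists ((`|lam ord_max| + `|mu ord0|) / 2); split=> [|i|j].
- by rewrite divr_gt0 // ltr_wpDl // (le_lt_trans _ lt_lm).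
- by rewrite (le_lt_trans (lam_max ord_max _ i)) // midf_lt.
- by rewrite (lt_le_trans _ (mu_min ord0 _ j)) // midf_lt.
Qed.

(** * Orbits of solutions *)

Definition orbit_seq (R : realType) (g : R -> R) (x : R) (n : nat) : R[i] :=
  (iter n g x)%:C.

Lemma iter_maps (T : Type) (I : set T) (g : T -> T) n x :
  set_fun I I g -> I x -> I (iter n g x).
Proof. by move=> gI Ix; elim: n => //= n IHn; apply: gI. Qed.

(** The n-th relation along the orbit of x is the functional equation at g^n(x), which lies in [I];
    conversely n = 0 suffices. *)
Lemma satisfies_iter_eqP (R : realType) (I : set R) K (c : 'I_K.+1 -> R) g :
  set_fun I I g ->
  satisfies_iter_eq I c g <->
  forall x, I x -> forall n, moment (orbit_seq g x) (recurrence_poly c * 'X^n) = 0.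
Proof.
move=> gI; have momentE x n : moment (orbit_seq g x) (recurrence_poly c * 'X^n) =
    (\sum_(i < K.+1) c i * iter i g (iter n g x))%:C.
  rewrite mulr_suml linear_sum rmorph_sum; apply: eq_bigr => i _ /=.
  by rewrite -scalerAl -exprD linearZ /= momentXn /orbit_seq iterD rmorphM.
split=> [Hc x Ix n|Hc x Ix]; first by rewrite momentE Hc //; apply: iter_maps.
by apply: complexI; have := Hc x Ix 0%N; rewrite momentE.
Qed.

(** If g x = g y, the equations at x and y differ only in their terms of index 0. *)
Lemma satisfies_iter_eq_inj (R : realType) (I : set R) K (c : 'I_K.+1 -> R) g :
  c ord0 != 0 -> satisfies_iter_eq I c g ->
  forall x y, I x -> I y -> g x = g y -> x = y.
Proof.
move=> c0 Hc x y Ix Iy gxy; apply: (mulfI c0).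
have := etrans (Hc x Ix) (esym (Hc y Iy)); rewrite !big_ord_recl.
under eq_bigr do rewrite lift0 iterSr gxy -iterSr.
by move/addIr.
Qed.

Lemma continuous_inj_iter2_homo (R : realType) (I : set R) (g : R -> R) :
  is_interval I -> set_fun I I g -> {within I, continuous g} ->
  (forall x y, I x -> I y -> g x = g y -> x = y) ->
  forall x y, I x -> I y -> x <= y -> g (g x) <= g (g y).
Proof.
(* [Rhull I] presents the set [I] as an interval object, the form in which continuity and
   injectivity yield strict monotonicity. *)
move=> /is_intervalP EI gI; rewrite EI => gc ginj.
have {}ginj : {in Rhull I &, injective g}.
  by move=> x y Ix Iy; apply: ginj.
have := unstable.strict_monotonicW (itv_continuous_inj_mono gc ginj).
have mem_hull x : I x -> x \in Rhull I by rewrite {1}EI.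
case=> gm x y; rewrite -EI => Ix Iy xy.
  by apply: gm (gm _ _ _ _ xy); apply: mem_hull => //; apply: gI.
by apply: gm (gm _ _ _ _ xy); apply: mem_hull => //; apply: gI.
Qed.

Theorem theorem3p6 (R : realType) (I : set R)
  (I_itv : is_interval I)
  (I_nondeg : exists x y : R, [/\ I x, I y & x < y])
  (N : nat) (N_ge1 : (1 <= N)%N)
  (a : 'I_N.+1 -> R) (a0_neq0 : a ord0 != 0) (aN_neq0 : a ord_max != 0)
  (p q : nat)
  (lam : 'I_p -> R[i]) (l : 'I_p -> nat)
  (mu : 'I_q -> R[i]) (k : 'I_q -> nat)
  (a_roots : roots_mult_listed a
     ((1, 1%N) :: [seq (lam i, l i) | i <- enum 'I_p]
      ++ flatten [seq [:: (mu j, k j); ((mu j)^*, k j)] | j <- enum 'I_q]))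
  (chain : modulus_chain lam mu)
  (M : nat) (b : 'I_M.+1 -> R) (bM_neq0 : b ord_max != 0)
  (b_roots : roots_mult_listed b
     ((1, 1%N) :: [seq (lam i, l i) | i <- enum 'I_p]))
  (g : R -> R) (g_maps : set_fun I I g)
  (g_cont : {within I, continuous g}) :
  satisfies_iter_eq I a g <-> satisfies_iter_eq I b g.
Proof.
(* A real mu_j would equal its conjugate and be listed twice. *)
have mu_nonreal j : complex.Im (mu j) != 0.
  have jq : j \in enum 'I_q by rewrite mem_enum.
  have [+ _] := a_roots; rewrite /unzip1 /= map_cat map_flatten cat_uniq.
  rewrite -(map_comp _ _ (enum 'I_q)).
  move=> /and4P[_ _ _ /uniq_flatten/(_ j jq)] /=.
  rewrite inE andbT; apply: contraNneq => y0.
  by apply/eqP; case: (mu j) y0 => x y /= ->; rewrite oppr0.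
have [rho [rho0 lam_rho rho_mu]] : exists rho : R[i],
    [/\ 0 < rho, forall i, `|lam i| < rho & forall j, rho < `|mu j|].
  apply: modulus_chain_separation chain _ => j.
  by apply: contraNneq (mu_nonreal j) => ->.
pose A := \prod_i ('X - (lam i)%:P) ^+ l i.
pose C := \prod_(j <- enum 'I_q)
  (('X - (mu j)%:P) ^+ k j * ('X - ((mu j)^*)%:P) ^+ k j).
have A_monic : A \is monic.
  by apply: monic_prod => i _; rewrite monic_exp ?monicXsubC.
have A_roots z : root A z -> `|z| < rho.
  rewrite rootE horner_prod => /prodf_eq0[i _].
  by rewrite hornerE expf_eq0 hornerXsubC subr_eq0 => /andP[_ /eqP ->].
have C_roots z : root C z -> rho < `|z|.
  rewrite rootE horner_prod prodf_seq_eq0 => /hasP[j _].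
  rewrite !hornerE mulf_eq0 !expf_eq0 !subr_eq0.
  by case/orP=> /andP[_ /eqP ->] //; rewrite normcJ.
have C0 : C != 0.
  rewrite prodf_seq_neq0; apply/allP => j _.
  by rewrite /= mulf_neq0 // expf_neq0 // polyXsubC_eq0.
have Eb : recurrence_poly b = (b ord_max)%:C *: (('X - 1) * A).
  rewrite (recurrence_poly_factor bM_neq0 b_roots) big_cons /= expr1.
  by rewrite big_map big_enum.
have Ea : recurrence_poly a = (a ord_max)%:C *: (('X - 1) * A * C).
  rewrite (recurrence_poly_factor aN_neq0 a_roots) big_cons big_cat /= expr1.
  rewrite big_map big_enum mulrA; congr (_ *: (_ * _)).
  rewrite big_flatten big_map; apply: eq_bigr => j _.
  by rewrite !big_cons big_nil /= mulr1.
have coef0 (r : R) : r != 0 -> r%:C != 0.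
  by rewrite -(rmorph0 (real_complex R)) (inj_eq (@complexI R)).
split=> sat; apply/satisfies_iter_eqP => // x Ix n; last first.
  (* From [b] to [a]: (X - 1) A kills the orbit, hence so does its multiple by C. *)
  have /satisfies_iter_eqP-/(_ g_maps x Ix) b0 := sat.
  rewrite Ea -scalerAl linearZ -[_ * C * _]mulrA /= scalar_ideal ?mulr0 // => m.
  apply: (mulfI (coef0 _ bM_neq0)).
  by rewrite mulr0 -(b0 m) Eb -scalerAl linearZ.
have g_inj := satisfies_iter_eq_inj a0_neq0 sat.
have g2_homo := continuous_inj_iter2_homo I_itv g_maps g_cont g_inj.
rewrite Eb -scalerAl linearZ /=.
have -> : moment (orbit_seq g x) (('X - 1) * A * 'X^n) = 0; last by rewrite mulr0.
apply: (nonreal_part_vanishes rho0 A_monic A_roots C0 C_roots) => [|{}n|{}n].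
- exact: nonreal_pairs_dvd.
- have momentE m : moment (orbit_seq g x) (('X - 1) * 'X^m) =
      (iter m.+1 g x - iter m g x)%:C.
    by rewrite mulrBl mul1r -exprS linearB /= !momentXn rmorphB.
  have iter_homo i : forall y z, I y -> I z -> y <= z ->
      iter i.*2 g y <= iter i.*2 g z.
    elim: i => // i IHi y z Iy Iz yz; rewrite doubleS !iterS.
    by apply: g2_homo; [apply: iter_maps|apply: iter_maps|apply: IHi].
  have In m : I (iter m g x) by apply: iter_maps.
  (* The difference d_(n+2i) is g^(2i)(g^(n+1)(x)) - g^(2i)(g^n(x)), and g^(2i) preserves order on
     [I]; hence d_n decides the sign. *)
  have [le|/ltW le] := leP (iter n g x) (iter n.+1 g x); [left|right] => i;
    rewrite /= momentE -addSn !(addnC _ i.*2) !iterD.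
    by rewrite ler0c subr_ge0 iter_homo.
  by rewrite -oppr_ge0 -rmorphN opprB ler0c subr_ge0 iter_homo.
- have /satisfies_iter_eqP-/(_ g_maps x Ix n) := sat.
  rewrite Ea -scalerAl linearZ => /eqP; rewrite mulf_eq0.
  by rewrite (negPf (coef0 _ aN_neq0)) => /eqP.
Qed.
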